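(* Let $\mathcal{M}$ be a matroid with $n$ elements and rank $r\geq 1$, with distinct element weights. Consider the following online algorithm, which uses only comparisons between weights of elements already seen. With probability $1/2$, run the classical secretary algorithm (observe the first $\lfloor n/e\rfloor$ elements, then accept the first element heavier than all observed ones). Otherwise: draw $m\sim\mathrm{Bin}(n,1/2)$, call the first $m$ arriving elements the sample, and compute the maximum-weight independent set $A=\{a_1,\dots,a_k\}$ of the sample with $w(a_1)\geq\dots\geq w(a_k)$; choose $\ell\in\{1,3,9,\dots,3^t\}$ uniformly at random, where $t=\lfloor\log_3 r\rfloor$ if $r$ is known, and otherwise $t$ is chosen uniformly from $\{\lfloor\log_3 k\rfloor,\lfloor\log_3 k\rfloor+1\}$; then run the greedy procedure (accept an element if the accepted set stays independent) on the non-sampled elements, as they arrive, that are heavier than $a_\ell$ (on all non-sampled elements if $\ell>k$). Then, in both versions (rank known or unknown), this algorithm is $O(\log r)$-competitive in the zero information model: there is an absolute constant $c$ such that $c\,(1+\log r)\,\mathbb{E}[w(\mathrm{ALG})]\geq w(\mathrm{OPT})$ for every matroid of rank $r$ and every weight assignment.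
   Context: Zero information model of the matroid secretary problem: an adversary assigns arbitrary nonnegative weights to the elements; the elements are revealed in uniformly random order; the online algorithm irrevocably accepts or rejects each element on arrival, keeping the accepted set independent. $\mathrm{OPT}$ is a maximum-weight independent set of $\mathcal{M}$ and $w(S)=\sum_{e\in S}w(e)$; the expectation is over the random order and the algorithm's randomness. *)

(* Defs.v *)
From HB Require Import structures.
From mathcomp Require Import all_boot all_order all_algebra all_fingroup.
From mathcomp Require Import reals sequences exp.
Set Implicit Arguments. Unset Strict Implicit. Unset Printing Implicit Defensive.
Import Order.TTheory GRing.Theory Num.Theory.
Local Open Scope ring_scope.

Record matroid (n : nat) := Matroid {
  indep : {set 'I_n} -> bool;
  indep0 : indep set0;
  indep_sub : forall A B : {set 'I_n}, A \subset B -> indep B -> indep A;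
  indep_exch : forall A B : {set 'I_n}, indep A -> indep B -> (#|A| < #|B|)%N ->
     exists2 x, x \in B :\: A & indep (x |: A)
}.

Definition mrank n (M : matroid n) : nat := \max_(A : {set 'I_n} | indep M A) #|A|.

Section Alg.
Variables (R : realType) (n : nat) (M : matroid n) (w : 'I_n -> R).

Definition wsum (S : {set 'I_n}) : R := \sum_(e in S) w e.

Definition wOPT : R := \big[Order.max/0]_(A : {set 'I_n} | indep M A) wsum A.

Definition arrival (sigma : 'S_n) : seq 'I_n := [seq sigma i | i <- enum 'I_n].

Definition greedy (P : 'I_n -> bool) (s : seq 'I_n) : {set 'I_n} :=
  foldl (fun S e => if P e && indep M (e |: S) then e |: S else S) set0 s.

Definition sort_desc (s : seq 'I_n) : seq 'I_n := sort (fun x y => w y <= w x) s.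

(* the maximum-weight independent set (max-weight basis) of the sample,
   computed by the greedy algorithm in decreasing weight order *)
Definition sampleOPT (sigma : 'S_n) (m : nat) : {set 'I_n} :=
  greedy predT (sort_desc (take m (arrival sigma))).

Definition sampleW (sigma : 'S_n) (m : nat) : seq R :=
  map w (sort_desc (enum (sampleOPT sigma m))).

Definition alg_thresh (sigma : 'S_n) (m ell : nat) : R :=
  let ws := sampleW sigma m in
  wsum (greedy (fun e => (size ws < ell)%N || (nth 0 ws ell.-1 < w e))
               (drop m (arrival sigma))).

(* classical secretary branch: observe floor(n/e) elements, then accept the
   first element heavier than all observed ones (whose acceptance keeps the
   accepted set independent, i.e. which is not a loop) *)
Definition classic (sigma : 'S_n) : R :=
  let s0 := Num.truncn (n%:R / @expR R 1) in
  let obs := take s0 (arrival sigma) in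
  let cand := [seq e <- drop s0 (arrival sigma) |
               all (fun x => w x < w e) obs && indep M [set e]] in
  if cand is e :: _ then w e else 0.

Definition Eord (f : 'S_n -> R) : R := (n`!%:R)^-1 * \sum_(sigma : 'S_n) f sigma.

Definition Eell (t : nat) (g : nat -> R) : R :=
  (t.+1%:R)^-1 * \sum_(j < t.+1) g (3 ^ j)%N.

Definition Ebin (g : nat -> R) : R :=
  \sum_(m < n.+1) ('C(n, m)%:R / 2 ^+ n) * g m.

Definition E_known : R :=
  2^-1 * Eord classic +
  2^-1 * Ebin (fun m => Eord (fun sigma =>
           Eell (trunc_log 3 (mrank M)) (fun ell => alg_thresh sigma m ell))).

Definition E_unknown : R :=
  2^-1 * Eord classic +
  2^-1 * Ebin (fun m => Eord (fun sigma =>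
           let t0 := trunc_log 3 #|sampleOPT sigma m| in
           2^-1 * Eell t0 (fun ell => alg_thresh sigma m ell) +
           2^-1 * Eell t0.+1 (fun ell => alg_thresh sigma m ell))).

End Alg.

(* Main.v *)
(** Let x_0, x_1, ... be the optimum in decreasing order of weight, S the sample, and
    A its greedy basis.  The binomial cut makes S a uniformly random subset.  The
    ell-th heaviest element of A is never heavier than x_(ell-1), and it is at least as
    heavy as x_(3ell-1) as soon as S meets x_ell, ..., x_(3ell-1) in at least ell
    elements, an event of probability at least 1/2 which is independent of
    S /\ {x_0, ..., x_(ell-1)}.  Hence the greedy procedure collects in expectation at
    least (ell/4) w(x_(3ell-1)), and summing over ell = 3^j recovers the optimum up to
    the first two elements.  For these, ell = 1 is enough: if x_0 is not sampled and the
    second heaviest non-loop is, then exactly x_0 is accepted.  On the former events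
    ell <= #|A|, so that ell is in the range used when the rank is unknown; ell = 1
    always is.

    The classical secretary branch is only bounded below by 0: heavy loops may keep it
    from ever accepting an element. *)
Require Import Defs.
From mathcomp Require Import all_boot all_order all_algebra all_fingroup.
From mathcomp Require Import reals sequences exp.
From mathcomp Require Import ring lra zify.
Set Implicit Arguments. Unset Strict Implicit. Unset Printing Implicit Defensive.
Import Order.TTheory GRing.Theory Num.Theory.
Local Open Scope ring_scope.

(** * The greedy procedure on an arbitrary arrival order *)

Section Greedy.
Context (n : nat) (M : matroid n).
Implicit Types (P : 'I_n -> bool) (s : seq 'I_n) (I : {set 'I_n}).

Lemma greedy_rcons P s e :
  greedy M P (rcons s e) =
  if P e && indep M (e |: greedy M P s) then e |: greedy M P s else greedy M P s.
Proof. by rewrite /greedy foldl_rcons. Qed.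

Lemma greedy_mem P s e : e \in greedy M P s -> (e \in s) && P e.
Proof.
elim/last_ind: s => [|s x IHs]; first by rewrite inE.
rewrite greedy_rcons mem_rcons inE.
case: ifP => [/andP[Px _]|_].
  by case/setU1P=> [->|/IHs/andP[-> ->]]; rewrite ?eqxx ?orbT.
by move=> /IHs/andP[-> ->]; rewrite orbT.
Qed.

Lemma greedy_indep P s : indep M (greedy M P s).
Proof.
elim/last_ind: s => [|s x IHs]; first exact: indep0.
by rewrite greedy_rcons; case: ifP => [/andP[]|].
Qed.

Lemma greedy_catl P s1 s2 : greedy M P s1 \subset greedy M P (s1 ++ s2).
Proof.
elim/last_ind: s2 => [|s x IHs]; first by rewrite cats0.
rewrite -rcons_cat greedy_rcons; case: ifP => // _.
exact: subset_trans IHs (subsetUr _ _).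
Qed.

(** The accepted set only grows, so by heredity an element compatible with the final set was
    compatible when it arrived. *)
Lemma greedy_max P s e :
  e \in s -> P e -> indep M (e |: greedy M P s) -> e \in greedy M P s.
Proof.
elim/last_ind: s => // s x IHs.
rewrite mem_rcons inE => es Pe indepe.
have sub : greedy M P s \subset greedy M P (rcons s x).
  by rewrite -cats1 greedy_catl.
have indepe' : indep M (e |: greedy M P s) := indep_sub (setUS _ sub) indepe.
case/predU1P: es => [ex|es]; last exact: (subsetP sub) (IHs es Pe indepe').
by rewrite greedy_rcons -ex Pe indepe' setU11.
Qed.

(** A larger [I] would provide, by exchange, an eligible element compatible with the final greedy
    set, against [greedy_max]. *)
Lemma greedy_card P s I :
  indep M I -> {in I, forall e, (e \in s) && P e} -> (#|I| <= #|greedy M P s|)%N.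
Proof.
move=> indepI sI; rewrite leqNgt; apply/negP.
move=> /(indep_exch (greedy_indep P s) indepI)[x /setDP[xI xG] indepx].
by case/andP: (sI _ xI) => xs Px; rewrite greedy_max in xG.
Qed.

End Greedy.

(** * Decreasing sequences: prefixes and counts above a level *)

Lemma sorted_filter_cat (T : eqType) (r : rel T) (p : pred T) (s : seq T) :
  transitive r -> (forall x y, r x y -> p y -> p x) -> sorted r s ->
  s = filter p s ++ filter (predC p) s.
Proof.
move=> r_tr rp; elim: s => //= x s IHs xs.
have {}IHs := IHs (path_sorted xs).
case: ifP => /= px; first by rewrite -IHs.
suff ps : all (predC p) s.
  move: (ps); rewrite all_predC has_filter negbK => /eqP ->.
  by rewrite (all_filterP ps).
have := order_path_min r_tr xs; apply: sub_all => y /= rxy.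
by apply/negP => /(rp _ _ rxy); rewrite px.
Qed.

Section SortedValues.
Context (R : realType).
Implicit Types (v : seq R) (a : R).

Lemma nth_sorted_ge v : sorted (>=%R) v -> all (>= 0) v ->
  forall i j, (i <= j)%N -> nth 0 v j <= nth 0 v i.
Proof.
move=> v_sorted v_ge0 i j ij.
have [jv|vj] := ltnP j (size v).
  by apply: (sorted_leq_nth ge_trans lexx) => //; rewrite inE (leq_ltn_trans ij).
rewrite (nth_default _ vj); have [iv|vi] := ltnP i (size v).
  exact: all_nthP.
by rewrite nth_default.
Qed.

Lemma count_gt_nth v a i : sorted (>=%R) v ->
  (i < count (>= a) v)%N -> a <= nth 0 v i.
Proof.
move=> v_sorted; apply: contraTT; rewrite -ltNge -leqNgt => va.
have [vi|iv] := leqP (size v) i; first exact: leq_trans (count_size _ _) vi.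
rewrite -(cat_take_drop i v) count_cat -[leqRHS]addn0 leq_add //.
  by rewrite (leq_trans (count_size _ _))// size_take_min geq_minl.
rewrite leqn0 eqn0Ngt -has_count -all_predC.
apply/(all_nthP 0) => j; rewrite size_drop nth_drop /= -ltNge => j_lt.
apply: le_lt_trans va; apply: (sorted_leq_nth ge_trans lexx) => //.
- by rewrite inE -ltn_subRL.
- by rewrite leq_addr.
Qed.

Lemma ltn_count_nth v i : sorted (>=%R) v ->
  (i < size v)%N -> (i < count (>= nth 0%R v i) v)%N.
Proof.
move=> v_sorted iv.
rewrite -[in X in count _ X](cat_take_drop i.+1 v) count_cat.
apply: leq_trans (leq_addr _ _).
suff : all (>= nth 0 v i) (take i.+1 v).
  by rewrite all_count => /eqP ->; rewrite size_takel.
apply/(all_nthP 0) => j; rewrite size_takel// => ji; rewrite nth_take//.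
by apply: (sorted_leq_nth ge_trans lexx) => //; rewrite inE (leq_trans ji).
Qed.

End SortedValues.

(** * Weights of a set in decreasing order *)

Definition weights (R : realType) (n : nat) (w : 'I_n -> R) (A : {set 'I_n}) : seq R :=
  map w (sort_desc w (enum A)).

Section Weights.
Context (R : realType) (n : nat) (w : 'I_n -> R).
Hypothesis w_ge0 : forall e, 0 <= w e.
Implicit Types (A B : {set 'I_n}) (e : 'I_n).

Local Notation ws := (weights w).

Lemma mem_sort_desc (s : seq 'I_n) : sort_desc w s =i s.
Proof. exact: mem_sort. Qed.

Lemma sort_desc_sorted (s : seq 'I_n) :
  sorted (fun x y => w y <= w x) (sort_desc w s).
Proof. by apply: sort_sorted => x y; apply: le_total. Qed.

Lemma size_weights A : size (ws A) = #|A|.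
Proof. by rewrite size_map size_sort -cardE. Qed.

Lemma weights_sorted A : sorted (>=%R) (ws A).
Proof. by rewrite sorted_map; apply: sort_desc_sorted. Qed.

Lemma weights_ge0 A : all (>= 0) (ws A).
Proof. by rewrite all_map; apply/allP => e _ /=. Qed.

Lemma count_weights A a : count (>= a) (ws A) = #|[set e in A | a <= w e]|.
Proof.
rewrite count_map (seq.permP (permEl (perm_sort _ _))) -sum1_count big_enum_cond.
by rewrite -sum1_card; apply: eq_bigl => e; rewrite inE.
Qed.

Lemma wsum_weights A : wsum w A = \sum_(i < #|A|) nth 0 (ws A) i.
Proof.
transitivity (\sum_(x <- ws A) x); last by rewrite (big_nth 0) big_mkord size_weights.
by rewrite big_map (perm_big _ (permEl (perm_sort _ _))) big_enum.
Qed.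

(** Taking for [a] the [i]-th weight of [B] shows that it is at most the [i]-th weight of [A]; the
    surplus weights of [A] are nonnegative. *)
Lemma le_wsum A B : (#|B| <= #|A|)%N ->
  (forall a, (#|[set e in B | (a <= w e)%R]| <= #|[set e in A | (a <= w e)%R]|)%N) ->
  wsum w B <= wsum w A.
Proof.
move=> leBA le_count; rewrite !wsum_weights.
rewrite (big_ord_widen _ (fun i => nth 0 (ws B) i) leBA) big_mkcond /=.
apply: ler_sum => i _; case: ifP => [iB|_]; last first.
  by apply: (all_nthP _ (weights_ge0 A)); rewrite size_weights.
apply: count_gt_nth (weights_sorted A) _; rewrite count_weights.
by apply: leq_trans (le_count _); rewrite -count_weights ltn_count_nth ?weights_sorted ?size_weights.
Qed.

End Weights.

(** Both the offline optimum (on [enum 'I_n]) and, by conversion, [sampleOPT] (on the first [m]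
    arrivals) are instances, so one set of lemmas serves both. *)
Definition maxweight_indep (R : realType) (n : nat) (M : matroid n) (w : 'I_n -> R)
  (s : seq 'I_n) : {set 'I_n} := greedy M predT (sort_desc w s).

(** * Order statistics of the optimum *)

Section Optimum.
Context (R : realType) (n : nat) (M : matroid n) (w : 'I_n -> R).
Hypothesis w_ge0 : forall e, 0 <= w e.
Hypothesis w_inj : injective w.
Implicit Types (s : seq 'I_n) (I : {set 'I_n}) (a : R) (sigma : 'S_n).

Local Notation mopt := (maxweight_indep M w).
Local Notation OPT := (mopt (enum 'I_n)).
Local Notation V := (nth 0 (weights w OPT)).

Lemma mopt_indep s : indep M (mopt s).
Proof. exact: greedy_indep. Qed.

Lemma mopt_sub s e : e \in mopt s -> e \in s.
Proof. by move=> /greedy_mem/andP[]; rewrite mem_sort_desc. Qed.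

(* Greedy in decreasing order solves every truncated problem at once: its
   elements of weight at least [a] span all elements of [s] of weight at least [a]. *)
Lemma mopt_card s I a : indep M I -> {in I, forall e, (e \in s) && (a <= w e)} ->
  (#|I| <= #|[set e in mopt s | (a <= w e)%R]|)%N.
Proof.
move=> indepI sI; pose heavy e := a <= w e.
have e_sort : sort_desc w s =
    filter heavy (sort_desc w s) ++ filter (predC heavy) (sort_desc w s).
  apply: (sorted_filter_cat (r := fun x y => w y <= w x)); last exact: sort_desc_sorted.
    by move=> y x z; apply: ge_trans.
  by move=> x y yx /le_trans; apply.
have top_sub : greedy M predT (filter heavy (sort_desc w s))
               \subset [set e in mopt s | a <= w e].
  apply/subsetP => e eG; rewrite inE; apply/andP; split.
    by rewrite /maxweight_indep e_sort (subsetP (greedy_catl _ _ _ _) _ eG).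
  by move: eG => /greedy_mem/andP[]; rewrite mem_filter => /andP[].
apply: leq_trans (subset_leq_card top_sub); apply: greedy_card => // e eI.
by have /andP[es ae] := sI e eI; rewrite mem_filter mem_sort_desc es /heavy ae.
Qed.

Lemma card_OPT : #|OPT| = mrank M.
Proof.
apply/eqP; rewrite eqn_leq; apply/andP; split.
  exact: (@leq_bigmax_cond _ (indep M) (fun A : {set 'I_n} => #|A|) OPT (mopt_indep _)).
apply/bigmax_leqP => I indepI; apply: greedy_card => // e _.
by rewrite mem_sort_desc mem_enum.
Qed.

Lemma wOPT_le : wOPT M w <= wsum w OPT.
Proof.
apply/bigmax_leP; split=> [|I indepI]; first exact: sumr_ge0.
apply: le_wsum => // [|a].
  by apply: greedy_card => // e _; rewrite mem_sort_desc mem_enum.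
apply: mopt_card => [|e]; last by rewrite inE mem_enum => /andP[].
by apply: indep_sub indepI; apply/subsetP => e; rewrite inE => /andP[].
Qed.

Lemma V_anti i j : (i <= j)%N -> V j <= V i.
Proof. exact/nth_sorted_ge/weights_ge0/w_ge0/weights_sorted. Qed.

Lemma V_ge0 i : 0 <= V i.
Proof.
have [iO|Oi] := ltnP i (size (weights w OPT)); last by rewrite nth_default.
by apply: all_nthP iO; apply: weights_ge0.
Qed.

Lemma le_V I a i : indep M I -> {in I, forall e, a <= w e} -> (i < #|I|)%N -> a <= V i.
Proof.
move=> indepI aI iI; apply: count_gt_nth; first exact: weights_sorted.
rewrite count_weights; apply: leq_trans iI _; apply: mopt_card => // e eI.
by rewrite mem_enum aI.
Qed.

(** The block x_i, ..., x_(i+k-1) of the optimum, as a set so that it can be intersected with the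
    sample. *)
Definition rank_block i k : {set 'I_n} :=
  [set e in take k (drop i (sort_desc w (enum OPT)))].

Lemma rank_block_sub i k : rank_block i k \subset OPT.
Proof.
apply/subsetP => e; rewrite inE => /mem_take/mem_drop.
by rewrite mem_sort_desc mem_enum.
Qed.

Lemma sort_desc_uniq : uniq (sort_desc w (enum OPT)).
Proof. by rewrite sort_uniq enum_uniq. Qed.

Lemma card_rank_block i k : (i + k <= mrank M)%N -> #|rank_block i k| = k.
Proof.
move=> ik; rewrite cardsE (card_uniqP _) ?take_uniq ?drop_uniq ?sort_desc_uniq//.
by rewrite size_takel// size_drop size_sort -cardE card_OPT leq_subRL ?(leq_trans _ ik)// leq_addr.
Qed.

Lemma rank_blockP i k e : e \in rank_block i k ->
  exists2 j, (i <= j < i + k)%N & w e = V j.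
Proof.
rewrite inE => /(nthP e)[j]; rewrite size_take_min size_drop leq_min => /andP[jk jO].
rewrite nth_take// nth_drop => <-; exists (i + j)%N; first by rewrite leq_addr ltn_add2l.
by rewrite (nth_map e) // -ltn_subRL.
Qed.

Lemma rank_block_disjoint i k l e :
  e \in rank_block i k -> e \notin rank_block (i + k) l.
Proof.
rewrite !inE addnC -drop_drop => ek; apply/negP => /mem_take el.
have := drop_uniq i sort_desc_uniq.
rewrite -(cat_take_drop k (drop i _)) cat_uniq => /and3P[_ /hasPn/(_ e el)] /=.
by rewrite ek.
Qed.

(** * Lower bounds on the threshold algorithm for a fixed sample *)

Definition sample sigma m : {set 'I_n} := [set e in take m (arrival sigma)].

Lemma mem_drop_arrival sigma m e :
  e \notin sample sigma m -> e \in drop m (arrival sigma).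
Proof.
have : e \in arrival sigma.
  by rewrite -[e](permKV sigma) map_f// mem_enum.
by rewrite -{1}(cat_take_drop m (arrival sigma)) mem_cat inE => /orP[->|].
Qed.

Lemma alg_thresh_ge0 sigma m ell : 0 <= alg_thresh M w sigma m ell.
Proof. exact: sumr_ge0. Qed.

(** Greedy accepts at least [#|I|] elements, each of weight at least [a]. Loops are never accepted,
    so their weights need no bound. *)
Lemma le_wsum_greedy P s I a : 0 <= a -> indep M I ->
  {in I, forall e, (e \in s) && P e} -> {in s, forall e, P e -> indep M [set e] -> a <= w e} ->
  #|I|%:R * a <= wsum w (greedy M P s).
Proof.
move=> a_ge0 indepI sI aP.
apply: (@le_trans _ _ (#|greedy M P s|%:R * a)).
  by rewrite ler_wpM2r// ler_nat greedy_card.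
rewrite mulr_natl -sumr_const; apply: ler_sum => e eG.
have /andP[es Pe] := greedy_mem eG; apply: aP => //.
by apply: indep_sub (greedy_indep M P s); rewrite sub1set.
Qed.

Lemma le_card_sampleOPT sigma m I : indep M I -> I \subset sample sigma m ->
  (#|I| <= #|sampleOPT M w sigma m|)%N.
Proof.
move=> indepI /subsetP IS; apply: greedy_card => // e /IS.
by rewrite inE mem_sort_desc => ->.
Qed.

(** The threshold lies between [V (3 * ell).-1] and [V ell.-1]: low enough to admit every unsampled
    element among the top [ell], high enough that each accepted element is worth [V (3 * ell).-1].
    The first conclusion serves the rank-unknown version. *)
Lemma alg_thresh_ge sigma m ell (S := sample sigma m) :
  (0 < ell)%N -> (3 * ell <= mrank M)%N ->
  (ell <= #|rank_block ell (2 * ell) :&: S|)%N ->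
  (ell <= #|sampleOPT M w sigma m|)%N /\
  #|rank_block 0 ell :\: S|%:R * V (3 * ell).-1 <= alg_thresh M w sigma m ell.
Proof.
set T := rank_block ell _ => ell_gt0 le_r T_sampled.
have indepTS : indep M (T :&: S).
  by apply: indep_sub (mopt_indep (enum 'I_n)); rewrite subIset// rank_block_sub.
have le_k : (ell <= #|sampleOPT M w sigma m|)%N.
  by apply: leq_trans T_sampled (le_card_sampleOPT indepTS (subsetIr _ _)).
split=> //; rewrite /alg_thresh /sampleW -/(weights w (sampleOPT M w sigma m)).
set ws := weights w (sampleOPT M w sigma m); have [el|el] := ltnP (size ws) ell.
  by move: el; rewrite size_weights ltnNge le_k.
set th := nth 0 ws ell.-1.
(* [T :&: S] is an independent subset of the sample with at least [ell] elements this heavy, so the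
   sample basis has as many. *)
have th_ge : V (3 * ell).-1 <= th.
  apply: count_gt_nth; first exact: weights_sorted.
  rewrite count_weights prednK//; apply: leq_trans T_sampled _.
  apply: mopt_card => // e /setIP[eT]; rewrite inE => -> /=.
  by have [j /andP[_ j3] ->] := rank_blockP eT; apply: V_anti; lia.
(* Conversely, the sample elements of [Q] are independent in the whole matroid, so the optimum has
   at least [ell] elements of weight at least [th]. *)
have th_le : th <= V ell.-1.
  pose Q := [set e in sampleOPT M w sigma m | th <= w e].
  apply: (@le_V Q) => [|e|]; last 2 first.
  - by rewrite inE => /andP[].
  - by rewrite -count_weights; apply: ltn_count_nth; rewrite ?weights_sorted// prednK.
  apply: indep_sub (mopt_indep (take m (arrival sigma))).
  by apply/subsetP => e; rewrite inE => /andP[].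
apply: le_wsum_greedy => [||e|e _ /=]; first exact: V_ge0.
- apply: indep_sub (mopt_indep (enum 'I_n)).
  by rewrite subDset subsetU// rank_block_sub orbT.
- move=> /setDP[eL eS]; rewrite mem_drop_arrival//= lt_neqAle.
  have [j /andP[_ j_lt] we] := rank_blockP eL.
  rewrite (le_trans th_le) ?andbT; last by rewrite we V_anti//; lia.
  (* The comparison is strict because [th] is the weight of a sampled element and weights are
     distinct. *)
  apply: contra eS => /eqP.
  have : th \in ws by rewrite mem_nth// prednK.
  case/mapP=> a; rewrite mem_sort_desc mem_enum => /mopt_sub aS tha.
  by rewrite tha => /w_inj <-; rewrite inE.
- by move=> /ltW/(le_trans th_ge).
Qed.

(* [#|Y| <= 2 * #|Y :&: S|] says that the second heaviest non-loop is sampled,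
   and is vacuous when there is only one. *)
Lemma alg_thresh1_ge : (0 < mrank M)%N -> exists x (Y : {set 'I_n}), x \notin Y /\
  forall sigma m (S := sample sigma m), x \notin S ->
    (#|Y| <= 2 * #|Y :&: S|)%N -> V 0 <= alg_thresh M w sigma m 1.
Proof.
move=> r_gt0.
have : (0 < #|rank_block 0 1|)%N by rewrite card_rank_block.
case/card_gt0P => x xL; exists x.
have [[|//] _ wx] := rank_blockP xL.
have indep1 e I : indep M I -> e \in I -> indep M [set e].
  by move=> indepI eI; apply: indep_sub indepI; rewrite sub1set.
have indepx : indep M [set x].
  by apply: indep1 (mopt_indep (enum 'I_n)) _; apply: (subsetP (rank_block_sub _ _) _ xL).
have le_wx e : indep M [set e] -> w e <= w x.
  by move=> indepe; rewrite wx; apply: (le_V indepe); rewrite ?cards1// => y /set1P->.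
(* A sampled non-loop [y] forces the threshold up to at least [w y], so no non-loop other than [x]
   passes; [x] passes, being the heaviest non-loop and unsampled. *)
have main sigma m : x \notin sample sigma m ->
    (forall e, e != x -> indep M [set e] ->
       exists2 y, indep M [set y] && (y \in sample sigma m) & w e <= w y) ->
    V 0 <= alg_thresh M w sigma m 1.
  move=> xS le_S; rewrite /alg_thresh /sampleW -/(weights w (sampleOPT M w sigma m)).
  set ws := weights w (sampleOPT M w sigma m).
  have -> : V 0 = #|[set x]|%:R * V 0 by rewrite cards1 mul1r.
  apply: le_wsum_greedy => [|//|e|e _ /= eP indepe].
  - exact: V_ge0.
  - move=> /set1P->; rewrite mem_drop_arrival//=.
    have [//|ws_gt0] := ltnP; rewrite /= lt_neqAle.
    have /mapP[a] : nth 0 ws 0 \in ws by rewrite mem_nth.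
    rewrite mem_sort_desc mem_enum => aA ->.
    rewrite le_wx ?(indep1 _ _ (mopt_indep (take m (arrival sigma))) aA)// andbT.
    by apply: contra xS => /eqP/w_inj <-; rewrite inE (mopt_sub aA).
  - have [->|ex] := eqVneq e x; first by rewrite wx.
    have [y /andP[indepy yS] ey] := le_S e ex indepe.
    have y_lt : (0 < count (>= w y) ws)%N.
      rewrite count_weights -(cards1 y); apply: mopt_card => // z /set1P->.
      by move: yS; rewrite inE => ->/=.
    case/orP: eP => [|/=]; first by rewrite ltnNge (leq_trans y_lt (count_size _ _)).
    rewrite ltNge (le_trans ey)//.
    by apply: count_gt_nth; first exact: weights_sorted.
pose P y := (y != x) && indep M [set y].
have [y0 Py0|P0] := pickP P; last first.
  exists set0; split=> [|sigma m S xS _]; first by rewrite inE.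
  by apply: main => // e ex indepe; have := P0 e; rewrite /P ex indepe.
case: (Order.TotalTheory.arg_maxP w Py0) => y /andP[yx indepy] y_max.
exists [set y]; split=> [|sigma m S xS]; first by rewrite inE eq_sym.
have [yS|yS] := boolP (y \in S); last first.
  by rewrite (_ : _ :&: _ = set0) ?cards0 ?cards1//; apply/setP => z; rewrite !inE;
     apply/andP => -[/eqP->]; rewrite inE in yS; apply/negP.
move=> _; apply: main => // e ex indepe; exists y; rewrite ?indepy//.
by apply: y_max; rewrite /P ex.
Qed.

End Optimum.

(** * The sample as a uniformly random subset *)

Section Sampling.
Context (R : realType) (n : nat).
Implicit Types (f : {set 'I_n} -> R) (S T : {set 'I_n}) (s : 'S_n).

(** List each set followed by its complement, and match the two lists position by position. *)
Lemma perm_imset_card S T : #|S| = #|T| -> exists s, s @: S = T.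
Proof.
move=> cardST; pose l (A : {set 'I_n}) := enum A ++ enum (~: A).
have l_uniq A : uniq (l A).
  rewrite cat_uniq !enum_uniq andbT; apply/hasPn => e.
  by rewrite mem_enum inE /= mem_enum.
have size_l A : size (l A) = n.
  by rewrite size_cat -!cardE cardsC card_ord.
have mem_l A e : e \in l A by rewrite mem_cat !mem_enum inE orbN.
pose g e := nth e (l T) (index e (l S)).
have g_inj : injective g.
  move=> x y; have ilt z : (index z (l S) < size (l T))%N.
    by rewrite (size_l T) -[ltnRHS](size_l S) index_mem.
  rewrite /g (set_nth_default y)// => /eqP; rewrite nth_uniq// => /eqP/(congr1 (nth x (l S))).
  by rewrite !nth_index.
exists (perm g_inj); apply/eqP; rewrite eqEcard card_imset ?cardST ?leqnn ?andbT; last exact: perm_inj.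
apply/subsetP => _ /imsetP[e eS ->]; rewrite permE /g nth_cat /l index_cat mem_enum eS.
have ilt : (index e (enum S) < size (enum T))%N.
  by rewrite -cardE -cardST cardE index_mem mem_enum.
by rewrite ilt -mem_enum mem_nth.
Qed.

(** The image of a fixed set under a uniform permutation is uniform among sets of its size, since
    all fibres have equal cardinality. *)
Lemma Eord_imset (D : {set 'I_n}) f :
  Eord (fun s => f (s @: D)) = 'C(n, #|D|)%:R^-1 * \sum_(S : {set 'I_n} | #|S| == #|D|) f S.
Proof.
pose N (S : {set 'I_n}) := #|[set s : 'S_n | s @: D == S]|.
(* If [p] maps [D] to [S], right multiplication by [p] maps the stabilizer of [D] bijectively onto
   the fibre over [S]. *)
have N_const (S : {set 'I_n}) : #|S| == #|D| -> N S = N D.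
  move=> /eqP/esym/perm_imset_card[p pD]; rewrite /N -[RHS](card_imset _ (mulIg p)).
  have imsetM s t : (s * t)%g @: D = t @: (s @: D).
    by rewrite -imset_comp; apply: eq_imset => e /=; rewrite permM.
  apply: eq_card => s; rewrite inE; apply/eqP/imsetP => [sD|[t + ->]].
    exists (s * p^-1)%g; last by rewrite mulgKV.
    by rewrite inE imsetM sD -pD -imsetM mulgV; apply/eqP; rewrite -[RHS]imset_id;
       apply: eq_imset => e; rewrite perm1.
  by rewrite inE imsetM => /eqP ->.
have sum_fib (F : {set 'I_n} -> R) :
    \sum_(s : 'S_n) F (s @: D) = (N D)%:R * \sum_(S : {set 'I_n} | #|S| == #|D|) F S.
  rewrite (partition_big (fun s : 'S_n => s @: D) (fun S : {set 'I_n} => #|S| == #|D|)) /=; last first.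
    by move=> s _; rewrite card_imset//; apply: perm_inj.
  rewrite mulr_sumr; apply: eq_bigr => S cardS.
  rewrite (eq_bigr (fun=> F S)) => [|s /eqP->//].
  rewrite sumr_const -(N_const S cardS) mulr_natl; congr (_ *+ _).
  by apply: eq_card => s; rewrite inE.
(* The fibre size comes from counting all permutations, that is, from [sum_fib] at the constant
   1. *)
have N_bin : (N D)%:R * 'C(n, #|D|)%:R = n`!%:R :> R.
  have := sum_fib (fun=> 1); rewrite !sumr_const card_Sn => ->.
  have := card_draws 'I_n #|D|; rewrite cardsE card_ord => <-.
  by congr (_ * _%:R); apply: eq_card.
have n_neq0 : n`!%:R != 0 :> R by rewrite pnatr_eq0 -lt0n fact_gt0.
rewrite /Eord sum_fib mulrA; congr (_ * _).
rewrite -N_bin invfM mulrAC mulVf ?mul1r//.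
by apply: contraNneq n_neq0 => N0; rewrite -N_bin N0 mul0r.
Qed.

(** The binomial weight of [m] cancels the number of [m]-subsets, leaving probability 2^-n for each
    set. *)
Lemma Ebin_Eord_sample f :
  Ebin n (fun m => Eord (fun s => f (sample s m))) = (2 ^+ n)^-1 * \sum_S f S.
Proof.
rewrite (partition_big (fun S : {set 'I_n} => inord #|S| : 'I_n.+1) xpredT)//= mulr_sumr.
apply: eq_bigr => m _; pose D : {set 'I_n} := [set i in take m (enum 'I_n)].
have cardD : #|D| = m.
  rewrite cardsE (card_uniqP _) ?take_uniq ?enum_uniq//.
  by rewrite size_takel// size_enum_ord -ltnS.
have sampleE s : sample s m = s @: D.
  apply/setP => e; rewrite inE /arrival -map_take.
  apply/mapP/imsetP => -[i iD ->]; exists i => //; by rewrite inE in iD *.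
transitivity ('C(n, m)%:R / 2 ^+ n * Eord (fun s => f (s @: D))).
  by congr (_ * (_ * _)); apply: eq_bigr => s _; rewrite sampleE.
have C_neq0 : 'C(n, m)%:R != 0 :> R.
  by rewrite pnatr_eq0 -lt0n bin_gt0 -ltnS.
rewrite Eord_imset cardD [_ / 2 ^+ n]mulrC -mulrA mulVKf//.
congr (_ * _); apply: eq_bigl => S; rewrite -(inj_eq val_inj) /= inordK//.
by rewrite ltnS -[leqRHS](card_ord n) max_card.
Qed.

Lemma ler_Ebin_Eord (F G : nat -> 'S_n -> R) : (forall m s, F m s <= G m s) ->
  Ebin n (fun m => Eord (F m)) <= Ebin n (fun m => Eord (G m)).
Proof.
move=> FG; apply: ler_sum => m _; rewrite ler_wpM2l ?divr_ge0 ?exprn_ge0//.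
by rewrite ler_wpM2l ?invr_ge0//; apply: ler_sum.
Qed.

(* Toggling [x], and replacing [T :&: S] by its complement in [T], are commuting
   involutions; every orbit contains a good [S]. *)
Lemma quarter_sample x T : x \notin T ->
  4^-1 <= (2 ^+ n)^-1 *
    \sum_(S : {set 'I_n}) ((x \notin S) && (#|T| <= 2 * #|T :&: S|)%N)%:R :> R.
Proof.
move=> xT; pose tog (D S : {set 'I_n}) : {set 'I_n} := [set e | (e \in S) (+) (e \in D)].
have togK D : involutive (tog D).
  by move=> S; apply/setP => e; rewrite !inE -addbA addbb addbF.
pose F (S : {set 'I_n}) : R := ((x \notin S) && (#|T| <= 2 * #|T :&: S|)%N)%:R.
have sum_tog D (G : {set 'I_n} -> R) : \sum_S G (tog D S) = \sum_S G S.
  by rewrite [RHS](reindex_inj (inv_inj (togK D))).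
(* Toggling [x] makes it unsampled if necessary, and one of [T :&: S] and [T :\: S] contains at
   least half of [T]. *)
have Fcover S : 1 <= F S + F (tog [set x] S) + F (tog T S) + F (tog T (tog [set x] S)).
  have Tx A : T :&: tog [set x] A = T :&: A.
    apply/setP => e; rewrite !inE; case: (eqVneq e x) => [->|_]; last by rewrite addbF.
    by rewrite (negbTE xT).
  have TT A : T :&: tog T A = T :\: (T :&: A).
    by apply/setP => e; rewrite !inE; case: (e \in T) => //=; rewrite ?addbT ?andbT ?andbF.
  rewrite /F !TT !Tx !inE eqxx (negbTE xT) !addbT !addbF.
  have := cardsID (T :&: S) T; rewrite setIA setIid.
  move: #|_ :\: _| #|_ :&: _| #|T| => b a c abc.
  case: (x \in S) => /=; case: (leqP c (2 * a)) => ?; case: (leqP c (2 * b)) => ? /=;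
    rewrite ?addr0 ?add0r ?lexx ?lerDl//; lia.
have : \sum_(S : {set 'I_n}) 1 <= 4 * \sum_S F S.
  have -> : 4 * \sum_S F S =
      \sum_S (F S + F (tog [set x] S) + F (tog T S) + F (tog T (tog [set x] S))).
    rewrite !big_split /= !sum_tog (sum_tog _ (fun S => F (tog T S))) sum_tog.
    by ring.
  exact: ler_sum.
rewrite sumr_const -cardsT -powersetT card_powerset cardsT card_ord natrX => le4.
by rewrite ler_pdivlMl ?exprn_gt0//; move: le4; rewrite /F; lra.
Qed.

End Sampling.

(** * Logarithm estimates and grouping of ranks by powers of 3 *)

Section Competitive.
Context (R : realType).

(** This is 1 + x <= exp x at x = -2/3; it yields the factor 3/2 of [trunc_log3_le]. *)
Lemma ln3_ge : 2 / 3 <= ln 3 :> R.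
Proof.
have exp_ge : (3^-1 : R) <= expR (- (2 / 3)).
  by apply: le_trans (expR_ge1Dx _); lra.
have : ln (3^-1 : R) <= ln (expR (- (2 / 3))) by rewrite ler_ln ?posrE ?invr_gt0 ?expR_gt0.
by rewrite expRK lnV ?posrE//; lra.
Qed.

Lemma trunc_log3_le r : (0 < r)%N ->
  (trunc_log 3 r).+1%:R <= 3 / 2 * (1 + ln r%:R) :> R.
Proof.
move=> r_gt0; have lnr : ln (3 ^ trunc_log 3 r)%:R <= ln r%:R :> R.
  by rewrite ler_ln ?posrE ?ltr0n ?expn_gt0// ler_nat trunc_logP.
rewrite natrX lnXn// -[X in X <= _]mulr_natl in lnr.
have := ler_wpM2l (ler0n R (trunc_log 3 r)) ln3_ge.
rewrite -(natr1 (trunc_log 3 r)); lra.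
Qed.

(** Indices 0 and 1 are charged to [V 0]. The indices from 3^(j+1)-1 to 3^(j+2)-2 number 6 * 3^j,
    and each term is at most the first of its block. *)
Lemma sum_le_geometric (V : nat -> R) J :
  (forall i, 0 <= V i) -> (forall i j, (i <= j)%N -> V j <= V i) ->
  \sum_(0 <= i < (3 ^ J.+1).-1) V i <=
    2 * V 0%N + 6 * \sum_(j < J) (3 ^ j)%:R * V (3 ^ j.+1).-1.
Proof.
move=> V_ge0 V_anti; elim: J => [|J IHJ].
  rewrite big_ord0 unlock /=.
  by have := V_anti 0%N 1%N isT; lra.
have pow_gt0 : (0 < 3 ^ J)%N by rewrite expn_gt0.
rewrite (@big_cat_nat _ _ _ (3 ^ J.+1).-1) /= ?leq0n//; last by rewrite !expnS; lia.
rewrite big_ord_recr /= mulrDr addrA lerD//.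
set a := (3 ^ J.+1).-1.
apply: (@le_trans _ _ (\sum_(a <= i < (3 ^ J.+2).-1) V a)).
  by apply: ler_sum_nat => i /andP[ai _]; apply: V_anti.
rewrite sumr_const_nat -[leLHS]mulr_natl mulrA -natrM /a.
by rewrite (_ : ((3 ^ J.+2).-1 - (3 ^ J.+1).-1)%N = (6 * 3 ^ J)%N)// !expnS; lia.
Qed.

(** * Comparison of both versions with the optimum *)

Context (n : nat) (M : matroid n) (w : 'I_n -> R).
Hypothesis w_ge0 : forall e, 0 <= w e.
Hypothesis w_inj : injective w.
Hypothesis r_gt0 : (0 < mrank M)%N.

Local Notation OPT := (maxweight_indep M w (enum 'I_n)).
Local Notation V := (nth 0 (weights w OPT)).
Local Notation t := (trunc_log 3 (mrank M)).
Local Notation E F := (Ebin n (fun m => Eord (fun s => F s m))).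

Lemma E_scale (c : R) (F : 'S_n -> nat -> R) : E (fun s m => c * F s m) = c * E F.
Proof.
rewrite /Ebin mulr_sumr; apply: eq_bigr => m _.
by rewrite /Eord -mulr_sumr; ring.
Qed.

Definition sample_trunc (s : 'S_n) m := trunc_log 3 #|sampleOPT M w s m|.

Lemma sample_trunc_le s m : (sample_trunc s m <= t)%N.
Proof.
apply: leq_trunc_log; rewrite -(card_OPT M w).
by apply: greedy_card; [exact: mopt_indep|move=> e _; rewrite mem_sort_desc mem_enum].
Qed.

(** A common minorant for both versions: [ell] ranges over the smaller of the two rank-unknown
    ranges, which is contained in the rank-known one. The term [ell = 1] is present even when the
    sample basis is empty. *)
Definition thresh_sum (s : 'S_n) m : R :=
  \sum_(j < (sample_trunc s m).+1) alg_thresh M w s m (3 ^ j).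

Lemma classic_ge0 s : 0 <= classic M w s.
Proof. by rewrite /classic; case: [seq _ <- _ | _]. Qed.

Lemma Eord_classic_ge0 : 0 <= Eord (classic M w).
Proof. by rewrite mulr_ge0 ?invr_ge0// sumr_ge0// => s _; apply: classic_ge0. Qed.

Lemma sum_thresh_widen s m k : (sample_trunc s m <= k)%N ->
  thresh_sum s m <= \sum_(j < k.+1) alg_thresh M w s m (3 ^ j).
Proof.
move=> le_k; rewrite /thresh_sum.
rewrite (big_ord_widen k.+1 (fun j => alg_thresh M w s m (3 ^ j)))//.
by rewrite big_mkcond /=; apply: ler_sum => j _; case: ifP => // _; apply: alg_thresh_ge0.
Qed.

Lemma thresh_sum_ge0 s m : 0 <= thresh_sum s m.
Proof. by apply: sumr_ge0 => j _; apply: alg_thresh_ge0. Qed.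

Lemma Eell_thresh_ge0 s m k : 0 <= Eell k (fun ell => alg_thresh M w s m ell).
Proof. by rewrite mulr_ge0 ?invr_ge0// sumr_ge0// => j _; apply: alg_thresh_ge0. Qed.

Lemma E_known_ge : E thresh_sum <= 4 * t.+1%:R * E_known M w.
Proof.
have le_ts : E thresh_sum <=
    E (fun s m => (2 * t.+1%:R) * Eell t (fun ell => alg_thresh M w s m ell)).
  apply: ler_Ebin_Eord => m s; rewrite -mulrA [X in 2 * X]mulVKf ?pnatr_eq0//.
  have le_t := sum_thresh_widen (sample_trunc_le s m).
  by apply: le_trans le_t _; rewrite ler_peMl ?ler1n// sumr_ge0// => j _; apply: alg_thresh_ge0.
apply: le_trans le_ts _; rewrite E_scale /E_known mulrDr.
have C_ge0 : 0 <= 4 * t.+1%:R * (2^-1 * Eord (classic M w)).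
  by rewrite mulr_ge0// mulr_ge0 ?invr_ge0 ?Eord_classic_ge0.
by lra.
Qed.

(** One factor 2 pays for the classical branch and one for the larger range of [ell], both bounded
    below by 0; [t.+1] pays for averaging over [ell]. *)
Lemma E_unknown_ge : E thresh_sum <= 4 * t.+1%:R * E_unknown M w.
Proof.
pose Y s m := 2^-1 * Eell (sample_trunc s m) (fun ell => alg_thresh M w s m ell) +
  2^-1 * Eell (sample_trunc s m).+1 (fun ell => alg_thresh M w s m ell).
have le_ts : E thresh_sum <= E (fun s m => (2 * t.+1%:R) * Y s m).
  apply: ler_Ebin_Eord => m s; rewrite /Y mulrDr.
  set X1 := Eell _ _; set X2 := Eell _ _.
  have X2_ge0 : 0 <= X2 := Eell_thresh_ge0 _ _ _.
  have X1_ge0 : 0 <= X1 := Eell_thresh_ge0 _ _ _.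
  have -> : thresh_sum s m = (sample_trunc s m).+1%:R * X1.
    by rewrite /X1 /Eell mulVKf ?pnatr_eq0.
  have le_t : (sample_trunc s m).+1%:R <= t.+1%:R :> R.
    by rewrite ler_nat ltnS sample_trunc_le.
  have := ler_wpM2r X1_ge0 le_t.
  have : 0 <= t.+1%:R * X2 by rewrite mulr_ge0.
  lra.
apply: le_trans le_ts _; rewrite E_scale /E_unknown mulrDr.
have C_ge0 : 0 <= 4 * t.+1%:R * (2^-1 * Eord (classic M w)).
  by rewrite mulr_ge0// mulr_ge0 ?invr_ge0 ?Eord_classic_ge0.
rewrite /Y /sample_trunc; lra.
Qed.

(** Only [ell = 1] is used, on the event of [alg_thresh1_ge], of probability at least 1/4. *)
Lemma thresh_sum_head : V 0%N <= 4 * E thresh_sum.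
Proof.
have [x [Y [xY main]]] := alg_thresh1_ge w_ge0 w_inj r_gt0.
pose good (S : {set 'I_n}) : R := ((x \notin S) && (#|Y| <= 2 * #|Y :&: S|)%N)%:R.
have le_ts : E (fun s m => V 0%N * good (sample s m)) <= E thresh_sum.
  apply: ler_Ebin_Eord => m s; rewrite /good.
  case: andP => [[xS YS]|_]; last by rewrite mulr0 thresh_sum_ge0.
  rewrite mulr1 /thresh_sum big_ord_recl /= expn0; apply: le_trans (main _ _ xS YS) _.
  by rewrite lerDl sumr_ge0// => j _; apply: alg_thresh_ge0.
rewrite E_scale Ebin_Eord_sample in le_ts.
have := ler_wpM2l (V_ge0 M w_ge0 0) (quarter_sample R xY).
by rewrite /good in le_ts; lra.
Qed.

Lemma thresh_sum_tail :
  \sum_(j < t) (3 ^ j)%:R * V (3 ^ j.+1).-1 <= 4 * E thresh_sum.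
Proof.
pose T j := rank_block M w (3 ^ j) (2 * 3 ^ j).
pose L j := rank_block M w 0 (3 ^ j).
pose good j x (S : {set 'I_n}) : R :=
  ((x \notin S) && (#|T j| <= 2 * #|T j :&: S|)%N)%:R.
(* The count of unsampled elements of [L j] is split into indicators, so that [quarter_sample]
   applies to each [x] in [L j] with the disjoint block [T j]. *)
pose h (S : {set 'I_n}) := \sum_(j < t) \sum_(x in L j) V (3 ^ j.+1).-1 * good j x S.
have le_r (j : 'I_t) : (3 * 3 ^ j <= mrank M)%N.
  rewrite -expnS; apply: leq_trans (trunc_logP (isT : 1 < 3)%N r_gt0).
  by rewrite leq_exp2l.
have cardT (j : 'I_t) : #|T j| = (2 * 3 ^ j)%N.
  by rewrite card_rank_block//; have := le_r j; lia.
have le_ts : E (fun s m => h (sample s m)) <= E thresh_sum.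
  apply: ler_Ebin_Eord => m s; set S := sample s m.
  have cover : thresh_sum s m = \sum_(j < t.+1 | (j < (sample_trunc s m).+1)%N)
      alg_thresh M w s m (3 ^ j).
    rewrite /thresh_sum (big_ord_widen t.+1 (fun j => alg_thresh M w s m (3 ^ j)))//.
    by rewrite ltnS sample_trunc_le.
  rewrite cover big_mkcond big_ord_recr /=.
  apply: ler_wpDr; first by case: ifP => // _; apply: alg_thresh_ge0.
  apply: ler_sum => j _; rewrite /good cardT leq_pmul2l//.
  have [TS|TS] := leqP (3 ^ j) #|T j :&: S|; last first.
    rewrite big1 => [|x _]; last by rewrite andbF mulr0.
    by case: ifP => // _; apply: alg_thresh_ge0.
  have [le_k] := alg_thresh_ge w_ge0 w_inj (expn_gt0 3 j) (le_r j) TS.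
  (* [le_k] places [3 ^ j] in the range summed by [thresh_sum]. *)
  rewrite -expnS ltnS trunc_log_max//; apply: le_trans.
  rewrite -mulr_sumr mulrC ler_wpM2r ?V_ge0// -natr_sum ler_nat.
  rewrite -sum1_card big_mkcond [leqRHS]big_mkcond /=; apply: leq_sum => x _.
  by rewrite in_setD andbT; case: (x \in S); case: (x \in L j).
apply: le_trans (ler_wpM2l _ le_ts) => //; rewrite Ebin_Eord_sample /h.
rewrite exchange_big /= mulrA mulr_sumr; apply: ler_sum => j _.
rewrite exchange_big /= -(@card_rank_block _ _ M w 0 (3 ^ j)); last by have := le_r j; lia.
rewrite mulr_natl -sumr_const mulr_sumr; apply: ler_sum => x xL.
have xT : x \notin T j by have := rank_block_disjoint (2 * 3 ^ j) xL; rewrite add0n.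
rewrite -mulr_sumr.
have := ler_wpM2l (V_ge0 M w_ge0 (3 ^ j.+1).-1) (quarter_sample R xT).
rewrite /good; lra.
Qed.

(** The constant is 2 * 4 from the head plus 6 * 4 from the tail. *)
Lemma wOPT_le_thresh_sum : wOPT M w <= 32 * E thresh_sum.
Proof.
have V0 := V_ge0 M w_ge0; have Vanti := V_anti M w_ge0.
have le_geom : wsum w OPT <= \sum_(0 <= i < (3 ^ t.+1).-1) V i.
  (* Ranks from [mrank M] on only add nonnegative default terms, so the sum may be extended to a
     full power of 3. *)
  have le_r : (mrank M <= (3 ^ t.+1).-1)%N.
    by rewrite -ltnS prednK ?expn_gt0// trunc_log_ltn.
  rewrite wsum_weights card_OPT -(big_mkord xpredT (fun i => V i)).
  by rewrite [leRHS](@big_cat_nat _ _ _ (mrank M))//= lerDl sumr_ge0.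
have := wOPT_le M w_ge0; have := sum_le_geometric t V0 Vanti.
have := thresh_sum_head; have := thresh_sum_tail; lra.
Qed.

End Competitive.

Theorem theorem12 :
  exists c : nat,
  forall (R : realType) (n : nat) (M : matroid n) (w : 'I_n -> R),
    (1 <= mrank M)%N ->
    (forall e, 0 <= w e) ->
    injective w ->
    c%:R * (1 + ln (mrank M)%:R) * E_known M w >= wOPT M w /\
    c%:R * (1 + ln (mrank M)%:R) * E_unknown M w >= wOPT M w.
Proof.
(* 192 = 32 * 4 * 3/2, from [wOPT_le_thresh_sum], the comparison with each version, and
   [trunc_log3_le]. *)
exists 192%N => R n M w r_gt0 w_ge0 w_inj.
have le_OPT := wOPT_le_thresh_sum w_ge0 w_inj r_gt0.
have le_t := trunc_log3_le R r_gt0.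
have main (e : R) :
    Ebin n (fun m => Eord (fun s => thresh_sum M w s m)) <=
      4 * (trunc_log 3 (mrank M)).+1%:R * e ->
    wOPT M w <= 192%:R * (1 + ln (mrank M)%:R) * e.
  move=> le_e; have e_ge0 : 0 <= e.
    have c_gt0 : 0 < 4 * (trunc_log 3 (mrank M)).+1%:R :> R by rewrite mulr_gt0.
    rewrite -(pmulr_rge0 _ c_gt0); apply: le_trans le_e.
    have := V_ge0 M w_ge0 0; have := thresh_sum_head w_ge0 w_inj r_gt0; lra.
  have := ler_wpM2r e_ge0 le_t; lra.
by split; apply: main; [apply: E_known_ge | apply: E_unknown_ge].
Qed.
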